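(* Let $F$ be a hyperfield and let $\mathcal O$ be a valuation hyperring of $F$. Then $\mathcal O$ is a strict subhyperring of $F$, i.e. for all $a,b\in\mathcal O$ one has $a-b\subseteq\mathcal O$ and $ab\in\mathcal O$.
   Context: A hyperoperation $+$ on a nonempty set $H$ assigns to each $(x,y)\in H\times H$ a nonempty subset $x+y\subseteq H$; for subsets, $A+B=\bigcup_{a\in A,b\in B}(a+b)$. A canonical hypergroup is $(H,+,0)$ with $+$ an associative and commutative hyperoperation such that for every $x$ there is a unique $-x$ with $0\in x+(-x)$, and $z\in x+y$ implies $y\in z-x:=z+(-x)$. A hyperring is $(R,+,\cdot,0)$ with $(R,+,0)$ a canonical hypergroup, $(R,\cdot)$ a commutative semigroup with $x\cdot 0=0$, and $x(y+z)=xy+xz$ as sets. A hyperfield is a hyperring $F$ with unity $1\neq 0$ such that $F^\times=F\setminus\{0\}$ is a group under multiplication. A subset $S$ of a hyperring $R$ is a subhyperring if it is multiplicatively closed and, with the induced hyperaddition $a+_S b:=(a+b)\cap S$ ($a,b\in S$), it is itself a hyperring $(S,+_S,\cdot,0)$ (in particular $(a+b)\cap S$ is nonempty for all $a,b\in S$). A valuation hyperring of a hyperfield $F$ is a subhyperring $\mathcal O$ of $F$ such that for all $x\in F$, $x\in\mathcal O$ or $x^{-1}\in\mathcal O$ (for $x=0$ this means $0\in\mathcal O$). *)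

(* Defs.v *)
From mathcomp Require Import all_boot boolp classical_sets.

Set Implicit Arguments.
Unset Strict Implicit.
Unset Printing Implicit Defensive.

Local Open Scope classical_set_scope.

Definition hyperop (T : Type) := T -> T -> set T.

Definition setop (T : Type) (add : hyperop T) (A B : set T) : set T :=
  \bigcup_(a in A) \bigcup_(b in B) add a b.

(* The inverse [opp x] = -x is a function of [x] because it is required to
   exist and be unique. *)
Record is_canonical_hypergroup (T : Type) (add : hyperop T) (zero : T)
    (opp : T -> T) : Prop := {
  hyperadd_nonempty : forall x y, add x y !=set0;
  hyperaddA : forall x y z,
    setop add [set x] (add y z) = setop add (add x y) [set z];
  hyperaddC : commutative add;
  hyperoppP : forall x, unique (fun y => add x y zero) (opp x);
  hyperadd_rev : forall x y z, add x y z -> add z (opp x) y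
}.

Record is_hyperring (T : Type) (add : hyperop T) (mul : T -> T -> T)
    (zero : T) (opp : T -> T) : Prop := {
  hyperring_add : is_canonical_hypergroup add zero opp;
  hypermulA : associative mul;
  hypermulC : commutative mul;
  hypermulr0 : right_zero zero mul;
  hypermulDr : forall x y z, mul x @` add y z = add (mul x y) (mul x z)
}.

Record hyperring := Hyperring {
  hyper_sort :> Type;
  hadd : hyperop hyper_sort;
  hmul : hyper_sort -> hyper_sort -> hyper_sort;
  hzero : hyper_sort;
  hopp : hyper_sort -> hyper_sort;
  hyperringP : is_hyperring hadd hmul hzero hopp
}.
Arguments hzero {h}.

Declare Scope hyper_scope.
Delimit Scope hyper_scope with H.
Notation "0" := hzero : hyper_scope.
Notation "x + y" := (hadd x y) : hyper_scope.
Notation "- x" := (hopp x) : hyper_scope.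
Notation "x - y" := (hadd x (hopp y)) : hyper_scope.
Notation "x * y" := (hmul x y) : hyper_scope.
Local Open Scope hyper_scope.

(* The nonzero elements form a group under multiplication; associativity comes
   from the underlying hyperring. The value of [inv 0] is unspecified. *)
Record is_hyperfield (R : hyperring) (one : R) (inv : R -> R) : Prop := {
  hypermul1r : left_id one (@hmul R);
  hyperone_neq0 : one <> 0;
  hypermul_neq0 : forall x y : R, x <> 0 -> y <> 0 -> x * y <> 0;
  hyperinv_neq0 : forall x : R, x <> 0 -> inv x <> 0;
  hypermulVr : forall x : R, x <> 0 -> inv x * x = one
}.

Record hyperfield := Hyperfield {
  hyperfield_ring :> hyperring;
  hone : hyperfield_ring;
  hinv : hyperfield_ring -> hyperfield_ring;
  hyperfieldP : is_hyperfield hone hinv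
}.
Arguments hone {h}.

Notation "1" := hone : hyper_scope.
Notation "x ^-1" := (hinv x) : hyper_scope.

Section InducedStructure.
Variables (R : hyperring) (S : set R).

Definition induced_add : hyperop S :=
  fun a b => [set c | (val a + val b) (val c)].

Definition induced_mul (SM : forall a b : R, S a -> S b -> S (a * b))
    (a b : S) : S :=
  SigSub (mem_set (SM _ _ (set_valP a) (set_valP b))).

Definition induced_zero (S0 : S 0) : S := SigSub (mem_set S0).

End InducedStructure.

Record is_subhyperring (R : hyperring) (S : set R) : Prop := {
  subhyper_mul : forall a b : R, S a -> S b -> S (a * b);
  subhyper_zero : S 0;
  subhyper_hyperring : exists opp : S -> S,
    is_hyperring (@induced_add R S) (induced_mul subhyper_mul)
      (induced_zero subhyper_zero) opp
}.

Definition is_valuation_hyperring (F : hyperfield) (O : set F) : Prop :=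
  is_subhyperring O /\ forall x : F, O x \/ (x <> 0 /\ O x^-1).

Definition is_strict_subhyperring (R : hyperring) (S : set R) : Prop :=
  is_subhyperring S /\
  forall a b : R, S a -> S b -> a - b `<=` S /\ S (a * b).

(* Main.v *)
Require Import Defs.
From mathcomp Require Import all_boot boolp classical_sets.

(** Let [x] lie in [a - b] with [a], [b] in the valuation hyperring [O]. If
    [x] itself is not known to be in [O], then [y = x^-1] is, and scaling by
    [y] gives that [1] lies in [y a + y (- b)]. Now [1], [y], [a] and [- b] all
    belong to [O], so this is a statement about the hyperaddition induced on
    [O], where distributivity holds as an equality of sets. Hence [1 = y x']
    for some [x'] in both [a - b] and [O]. Cancelling [y] gives [x' = x], so
    [x] was in [O] all along: distributivity inside [O] does the work
    ([subhyperring_distr]), and the valuation property only supplies [y]. *)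

Local Open Scope classical_set_scope.
Local Open Scope hyper_scope.

(** The induced hyperaddition restricts the ambient one, so an opposite in [S]
    is an opposite in [R]; uniqueness of the latter identifies them. *)
Lemma subhyperring_opp {R : hyperring} {S : set R} {b : R} :
  is_subhyperring S -> S b -> S (- b).
Proof.
move=> [SM S0 [opp hS]] Sb.
pose b' : S := SigSub (mem_set Sb).
have [b'K _] := hyperoppP (hyperring_add hS) b'.
have [_ uniq_opp] := hyperoppP (hyperring_add (hyperringP R)) b.
by rewrite (uniq_opp (val (opp b')) b'K); exact: set_valP.
Qed.

(** An element of [y a + y b] that happens to lie in [S] is already the
    [y]-multiple of an element of [a + b] lying in [S]: this is the nontrivial
    inclusion in the distributivity of the induced structure. *)
Lemma subhyperring_distr {R : hyperring} {S : set R} {y a b c : R} :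
  is_subhyperring S -> S y -> S a -> S b -> S c ->
  (y * a + y * b)%H c -> exists x, [/\ S x, (a + b)%H x & y * x = c].
Proof.
move=> [SM S0 [opp hS]] Sy Sa Sb Sc yab_c.
pose toS (z : R) (Sz : S z) : S := SigSub (mem_set Sz).
have : induced_add (induced_mul SM (toS y Sy) (toS a Sa))
         (induced_mul SM (toS y Sy) (toS b Sb)) (toS c Sc) by [].
rewrite -(hypermulDr hS) => -[x abx yxc].
exists (val x); split; [exact: set_valP | exact: abx |].
exact: (congr1 val yxc).
Qed.

Lemma hypermulfI {F : hyperfield} {y u v : F} :
  y <> 0 -> y * u = y * v -> u = v.
Proof.
move=> y0 /(congr1 (hmul y^-1)).
rewrite !(hypermulA (hyperringP F)) (hypermulVr (hyperfieldP F) y0).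
by rewrite !(hypermul1r (hyperfieldP F)).
Qed.

Lemma valuation_hyperring1 {F : hyperfield} {O : set F} :
  is_valuation_hyperring O -> O 1.
Proof.
move=> [_ /(_ 1)[//|[one0]]].
rewrite -[1^-1](hypermul1r (hyperfieldP F)) (hypermulC (hyperringP F)).
by rewrite (hypermulVr (hyperfieldP F) one0).
Qed.

Theorem proposition4p7 (F : hyperfield) (O : set F)
    (hO : is_valuation_hyperring O) : is_strict_subhyperring O.
Proof.
have O1 := valuation_hyperring1 hO.
case: hO => subO valO; split=> // a b Oa Ob.
split; last exact: (subhyper_mul subO).
move=> x abx; have [//|[x0 Oy]] := valO x.
have yab1 : (x^-1 * a + x^-1 * - b)%H 1.
  rewrite -(hypermulDr (hyperringP F)).
  by exists x => //; exact: (hypermulVr (hyperfieldP F)).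
have [x' [Ox' _ yx'1]] :=
  subhyperring_distr subO Oy Oa (subhyperring_opp subO Ob) O1 yab1.
suff -> : x = x' by [].
apply: (hypermulfI (hyperinv_neq0 (hyperfieldP F) x0)).
by rewrite yx'1 (hypermulVr (hyperfieldP F) x0).
Qed.
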